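(* Let $\mathcal{A}$ be a subspace arrangement in $\mathbb{R}^n$ and let $A \in \mathcal{A}$. Then \[ \chi(\mathcal{A};x) = \chi(\mathcal{A}\setminus A;x) - \chi(\mathcal{A}/A;x). \]
   Context: A subspace arrangement in a real vector space $V$ is a finite collection $\mathcal{A}=\{A_1,\dots,A_t\}$ of linear subspaces of $V$, none of which contains another. Its intersection lattice $L_\mathcal{A}$ is the set of all intersections of subfamilies of $\mathcal{A}$ (the empty intersection being $V$), ordered by reverse inclusion; its least element is $\hat 0 = V$. The characteristic polynomial is $\chi(\mathcal{A};x)=\sum_{Y\in L_\mathcal{A}}\mu(\hat 0,Y)\,x^{\dim Y}$, where $\mu$ is the Möbius function of $L_\mathcal{A}$. For $A\in\mathcal{A}$, the deletion $\mathcal{A}\setminus A=\mathcal{A}\setminus\{A\}$ is regarded as an arrangement in $\mathbb{R}^n$, and the restriction $\mathcal{A}/A$ is the set of inclusion-maximal members of $\{A\cap B : B\in\mathcal{A}\setminus\{A\}\}$ (equivalently, the elements covering $A$ in $L_\mathcal{A}$), regarded as an arrangement in the ambient space $A$ (so its lattice has least element $A$). An empty arrangement in an ambient space $W$ has characteristic polynomial $x^{\dim W}$.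
   Formalization: The formal theorem additionally assumes that A is a proper subspace of R^n; this excludes only the one-element arrangement {R^n}, for which the stated identity would read x^n = 0 and is false. *)

(* Defs.v *)
From HB Require Import structures.
From mathcomp Require Import all_boot all_order all_algebra finmap reals.
Set Implicit Arguments.
Unset Strict Implicit.
Unset Printing Implicit Defensive.
Import GRing.Theory.
Local Open Scope ring_scope.
Local Open Scope fset_scope.

Section Moebius.
Variables (T : choiceType) (le : rel T) (L : {fset T}).

(* The standard recursion mu(x,x) = 1, mu(x,y) = - \sum_(x <= z < y) mu(x,z),
   with fuel k; the sum is empty when x is not below y. *)
Fixpoint moebius_rec (k : nat) (x y : T) : int :=
  if x == y then 1
  else if k is k'.+1 then
    - \sum_(z <- L | [&& le x z, le z y & z != y]) moebius_rec k' x z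
  else 0.

(* Chains of L have at most #|` L| elements, so the fuel never runs out:
   see moebiusE. *)
Definition moebius (x y : T) : int := moebius_rec #|` L| x y.

Lemma moebius_xx x : moebius x x = 1.
Proof. by rewrite /moebius; case: #|` L| => [|k] /=; rewrite eqxx. Qed.

Hypothesis le_refl : reflexive le.
Hypothesis le_anti : antisymmetric le.
Hypothesis le_trans : transitive le.

Let below y := [fset w in L | le w y].

Let below_lt z y : y \in L -> le z y -> z != y ->
  (#|` below z| < #|` below y|)%N.
Proof.
move=> yL zy nzy; apply: fproper_ltn_card; rewrite fproperE.
apply/andP; split.
  apply/fsubsetP => w; rewrite !inE /= => /andP[-> wz] /=.
  exact: le_trans zy.
apply/negP => /fsubsetP /(_ y); rewrite !inE /= yL le_refl => /(_ isT) yz.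
by case/eqP: nzy; apply: le_anti; rewrite zy.
Qed.

Let rec_stable k1 k2 x y : y \in L ->
  (#|` below y| <= k1)%N -> (#|` below y| <= k2)%N ->
  moebius_rec k1 x y = moebius_rec k2 x y.
Proof.
move=> yL; have pos : (0 < #|` below y|)%N.
  by rewrite cardfs_gt0; apply/fset0Pn; exists y; rewrite !inE /= yL le_refl.
elim: k1 k2 y yL pos => [|k1 IH] [|k2] y yL pos h1 h2;
  try by [rewrite leqNgt pos in h1 | rewrite leqNgt pos in h2].
rewrite /=; case: eqP => // _; congr (- _).
rewrite big_seq_cond [RHS]big_seq_cond.
apply: eq_bigr => z /andP[zL /and3P[_ zy nzy]].
have lt := below_lt yL zy nzy.
apply: IH => //; last 2 first.
- by rewrite -ltnS; apply: leq_trans lt _.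
- by rewrite -ltnS; apply: leq_trans lt _.
by rewrite cardfs_gt0; apply/fset0Pn; exists z; rewrite !inE /= zL le_refl.
Qed.

Lemma moebiusE x y : y \in L -> x != y ->
  moebius x y = - \sum_(z <- L | [&& le x z, le z y & z != y]) moebius x z.
Proof.
move=> yL nxy.
have bL z : (#|` below z| <= #|` L|)%N.
  by apply: fsubset_leq_card; apply/fsubsetP => w; rewrite !inE /= => /andP[].
rewrite {1}/moebius (@rec_stable _ #|` L|.+1) //= ?(negPf nxy) //.
exact: leqW.
Qed.

End Moebius.

Section Arrangements.
Variables (K : fieldType) (vT : vectType K).
Implicit Types (W A B Y : {vspace vT}) (AA : {fset {vspace vT}}).

(* The ambient space is a subspace W of vT, so that an arrangement in R^n
   (W = fullv) and its restriction (W = A) are instances of one notion. *)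
Definition arrangement W AA : Prop :=
  (forall A, A \in AA -> (A <= W)%VS) /\
  (forall A B, A \in AA -> B \in AA -> (A <= B)%VS -> A = B).

Definition intersection_lattice W AA : {fset {vspace vT}} :=
  [fset (W :&: \bigcap_(B <- (S : {fset {vspace vT}})) B)%VS
    | S in fpowerset AA].

Definition rev_incl : rel {vspace vT} := fun Y Z => (Z <= Y)%VS.

Definition arr_chi W AA : {poly int} :=
  \sum_(Y <- intersection_lattice W AA)
    moebius rev_incl (intersection_lattice W AA) W Y *: 'X^(\dim Y).

Definition deletion AA A : {fset {vspace vT}} := AA `\ A.

Definition maximal_members (C : {fset {vspace vT}}) : {fset {vspace vT}} :=
  [fset Y in C | all (fun Z => (Y <= Z)%VS ==> (Y == Z)) C].

Definition restriction AA A : {fset {vspace vT}} :=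
  maximal_members [fset (A :&: B)%VS | B in AA `\ A].

Lemma arr_chi0 W : arr_chi W fset0 = 'X^(\dim W).
Proof.
suff e : intersection_lattice W fset0 = [fset W].
  by rewrite /arr_chi e big_seq_fset1 moebius_xx scale1r.
rewrite /intersection_lattice fpowerset0; apply/fsetP => Y; rewrite !inE.
apply/imfsetP/eqP => /= [[S] | ->].
  by rewrite inE => /eqP -> ->; rewrite big_seq_fset0 capvf.
by exists fset0; rewrite ?inE // big_seq_fset0 capvf.
Qed.

Lemma arrangement_deletion W AA A :
  arrangement W AA -> arrangement W (deletion AA A).
Proof.
case=> sub anti; split=> [B | B C].
  by rewrite !inE => /andP[_ /sub].
by rewrite !inE => /andP[_ BA] /andP[_ CA]; apply: anti.
Qed.

Lemma arrangement_restriction AA A : arrangement A (restriction AA A).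
Proof.
split=> [Y | Y Z].
  by rewrite !inE /= => /andP[/imfsetP[B _ ->] _]; apply: capvSl.
by rewrite !inE /= => /andP[_ /allP h] /andP[ZC _] YZ;
  apply/eqP; move: (h Z ZC); rewrite YZ.
Qed.

End Arrangements.

(* Main.v *)
Require Import Defs.
From mathcomp Require Import all_boot all_order all_algebra finmap reals.
Local Open Scope ring_scope.

(** The characteristic polynomial is the Whitney sum
    [\sum_(S <= AA) (-1)^|S| x^(dim (W :&: \bigcap S))]: the coefficient of
    [x^(dim Y)] collected over the [S] with intersection [Y] satisfies the
    recursion defining [mu(W, Y)], since [\sum_(S) (-1)^|S|] over the subsets of
    [{B | Y <= B}] vanishes unless that set is empty.  Splitting the subsets [S]
    according to whether they contain [A] gives the Whitney sum of the deletion
    minus that of the family [A :&: B] in [A].  Discarding the non-maximal (or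
    repeated) members of that family does not change its sum: if [C <= D], the
    subsets containing [C] cancel in pairs by toggling [D]. *)

Set Implicit Arguments.
Unset Strict Implicit.
Unset Printing Implicit Defensive.
Import GRing.Theory.
Local Open Scope fset_scope.

Section WhitneySum.
Variables (K : fieldType) (vT : vectType K).
Implicit Types (V W B C D Y Z : {vspace vT}) (s t : seq {vspace vT}).

(* Unfolds to the sum of (-1)^|S| phi (W :&: \bigcap S) over the subfamilies S of s. *)
Fixpoint whitney_sum (M : zmodType) (phi : {vspace vT} -> M) W s : M :=
  if s is B :: s' then whitney_sum phi W s' - whitney_sum phi (W :&: B)%VS s'
  else phi W.

(** The invariant [P] limits the comparison to the spaces the recursion reaches; later it is
    membership in the intersection lattice. *)
Lemma eq_whitney_sum (M : zmodType) (P : pred {vspace vT})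
    (phi psi : {vspace vT} -> M) W s :
  (forall V B, P V -> B \in s -> P (V :&: B)%VS) ->
  (forall V, P V -> phi V = psi V) ->
  P W -> whitney_sum phi W s = whitney_sum psi W s.
Proof.
move=> + ephi; elim: s W => [|B s IH] W stab PW /=; first exact: ephi.
have stab' V C : P V -> C \in s -> P (V :&: C)%VS.
  by move=> PV Cs; apply: stab; rewrite // inE Cs orbT.
by rewrite !IH //; apply: stab; rewrite ?mem_head.
Qed.

Lemma whitney_sum_sum (M : zmodType) (I : Type) (r : seq I) (P : pred I)
    (F : I -> {vspace vT} -> M) W s :
  whitney_sum (fun V => \sum_(i <- r | P i) F i V) W s =
  \sum_(i <- r | P i) whitney_sum (F i) W s.
Proof. by elim: s W => [|B s IH] W //=; rewrite !IH -sumrB. Qed.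

Lemma whitney_sumZ (M : lmodType int) (c : {vspace vT} -> int) (x : M) W s :
  whitney_sum (fun V => c V *: x) W s = whitney_sum c W s *: x.
Proof. by elim: s W => [|B s IH] W //=; rewrite !IH -scalerBl. Qed.

(** Toggling [D] in a subfamily flips its sign and leaves its intersection with [W] unchanged. *)
Lemma whitney_sum_eq0 (M : zmodType) (phi : {vspace vT} -> M) W s D :
  D \in s -> (W <= D)%VS -> whitney_sum phi W s = 0.
Proof.
elim: s W => [|B s IH] W //=; rewrite inE => /orP[/eqP <- /capv_idPl -> | Ds WD].
  by rewrite subrr.
by rewrite !IH ?subr0 // (subv_trans (capvSl _ _)).
Qed.

Lemma whitney_sum_swap (M : zmodType) (phi : {vspace vT} -> M) W s B t :
  whitney_sum phi W (s ++ B :: t) = whitney_sum phi W (B :: s ++ t).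
Proof.
elim: s W => [|C s IH] W //=; rewrite !IH /= -!capvA (capvC B C).
by rewrite opprD addrACA -opprD.
Qed.

Lemma whitney_sum_catC (M : zmodType) (phi : {vspace vT} -> M) W s t :
  whitney_sum phi W (s ++ t) = whitney_sum phi W (t ++ s).
Proof.
by elim: s W => [|B s IH] W; rewrite ?cats0 // whitney_sum_swap /= !IH.
Qed.

(** The subfamilies containing [C] contribute a sum over [W :&: C], which lies inside some [D] of
    [t], so this sum vanishes. *)
Lemma whitney_sum_cat_dominated (M : zmodType) (phi : {vspace vT} -> M) W s t :
  {in s, forall C, exists2 D, D \in t & (W :&: C <= D)%VS} ->
  whitney_sum phi W (s ++ t) = whitney_sum phi W t.
Proof.
elim: s => [|C s IH] //= dom; have [D Dt CD] := dom C (mem_head _ _).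
rewrite (whitney_sum_eq0 _ (W := W :&: C) (D := D)) ?mem_cat ?Dt ?orbT // subr0.
by apply: IH => B Bs; apply: dom; rewrite inE Bs orbT.
Qed.

Lemma whitney_sum_cofinal (M : zmodType) (phi : {vspace vT} -> M) W s t :
  {in s, forall C, exists2 D, D \in t & (W :&: C <= D)%VS} ->
  {in t, forall C, exists2 D, D \in s & (W :&: C <= D)%VS} ->
  whitney_sum phi W s = whitney_sum phi W t.
Proof.
move=> st ts; rewrite -(whitney_sum_cat_dominated phi ts) whitney_sum_catC.
exact: whitney_sum_cat_dominated.
Qed.

Lemma whitney_sum_above W s Y : (Y <= W)%VS ->
  whitney_sum (fun V => (Y <= V)%VS%:R : int) W s =
  (~~ has (fun B => Y <= B)%VS s)%:R.
Proof.
have out V t : ~~ (Y <= V)%VS ->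
    whitney_sum (fun V => (Y <= V)%VS%:R : int) V t = 0.
  elim: t V => [|B t IH] V nYV /=; first by rewrite (negPf nYV).
  by rewrite !IH ?subr0 // subv_cap negb_and nYV.
elim: s W => [|B s IH] W YW /=; first by rewrite YW.
(* If [Y <= B], the two branches agree and cancel; otherwise the branch through [W :&: B] vanishes
   by [out]. *)
have [YB | nYB] /= := boolP (Y <= B)%VS.
  by rewrite !IH ?subv_cap ?YW // subrr.
by rewrite IH // out ?subr0 // subv_cap negb_and nYB orbT.
Qed.

End WhitneySum.

Section CharacteristicPolynomial.
Variables (K : fieldType) (vT : vectType K).
Implicit Types (W A B Y Z : {vspace vT}) (AA : {fset {vspace vT}}).
Implicit Types s : seq {vspace vT}.

Lemma lattice_ambient W AA : W \in intersection_lattice W AA.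
Proof.
apply/imfsetP; exists fset0; first by rewrite fpowersetE fsub0set.
by rewrite big_seq_fset0 capvf.
Qed.

Lemma lattice_sub W AA Y : Y \in intersection_lattice W AA -> (Y <= W)%VS.
Proof. by case/imfsetP => S _ ->; apply: capvSl. Qed.

Lemma lattice_cap W AA Y B : Y \in intersection_lattice W AA -> B \in AA ->
  (Y :&: B)%VS \in intersection_lattice W AA.
Proof.
case/imfsetP => S /=; rewrite fpowersetE => SA -> BA.
apply/imfsetP; exists (B |` S) => /=.
  by rewrite fpowersetE fsubUset fsub1set BA SA.
have [BS | nBS] := boolP (B \in S); last first.
  by rewrite big_fsetU1 //= -capvA; congr (_ :&: _)%VS; rewrite capvC.
rewrite (fsetUidPr _ _ _) ?fsub1set //; apply/capv_idPl.
by rewrite (big_fsetD1 B) //= (subv_trans (capvSr _ _)) ?capvSl.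
Qed.

Lemma lattice_below_member W AA Y : Y \in intersection_lattice W AA ->
  Y != W -> exists2 B, B \in AA & (Y <= B)%VS.
Proof.
case/imfsetP => S /=; rewrite fpowersetE => /fsubsetP SA ->.
have [-> | [B BS] _] := fset_0Vmem S; first by rewrite big_seq_fset0 capvf eqxx.
exists B; first exact: SA.
by rewrite (big_fsetD1 B) //= (subv_trans (capvSr _ _)) ?capvSl.
Qed.

Lemma rev_incl_refl : reflexive (@rev_incl K vT).
Proof. by move=> Y; apply: subvv. Qed.

Lemma rev_incl_anti : antisymmetric (@rev_incl K vT).
Proof. by move=> Y Z /andP[YZ ZY]; apply/eqP; rewrite eqEsubv; apply/andP. Qed.

Lemma rev_incl_trans : transitive (@rev_incl K vT).
Proof. by move=> Y X Z XY YZ; apply: subv_trans XY. Qed.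

(** The subfamilies are grouped by their intersection [Z]. Allowing any list [s] with the members of
    [AA] leaves the order free, so that a chosen member can come first. *)
Lemma whitney_sum_expand W AA s (M : lmodType int) (phi : {vspace vT} -> M) :
  s =i AA ->
  whitney_sum phi W s =
  \sum_(Z <- intersection_lattice W AA)
     whitney_sum (fun V => (V == Z)%:R : int) W s *: phi Z.
Proof.
set L := intersection_lattice W AA => sAA.
under [RHS]eq_bigr do rewrite -whitney_sumZ.
rewrite -whitney_sum_sum; apply: (eq_whitney_sum (P := mem L)).
- by move=> V B VL; rewrite sAA; apply: lattice_cap.
- move=> V VL; rewrite (big_fsetD1 V) //= eqxx scale1r big_seq big1 ?addr0 //.
  by move=> Z; rewrite !inE eq_sym => /andP[/negPf -> _]; rewrite scale0r.
- exact: lattice_ambient.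
Qed.

Lemma whitney_sum_above_lattice W AA s Y :
  s =i AA -> {in AA, forall B, ~~ (W <= B)%VS} ->
  Y \in intersection_lattice W AA ->
  \sum_(Z <- intersection_lattice W AA | (Y <= Z)%VS)
     whitney_sum (fun V => (V == Z)%:R : int) W s = (Y == W)%:R.
Proof.
move=> sAA proper YL; have YW := lattice_sub YL.
(* The regular module [int^o] lets [whitney_sum_expand], stated for modules over [int], apply to
   integer values. *)
transitivity (whitney_sum (fun V => (Y <= V)%VS%:R : int^o) W s).
  rewrite (whitney_sum_expand _ _ sAA) big_mkcond; apply: eq_bigr => Z _.
  by case: (Y <= Z)%VS; rewrite ?scaler0 // -[_ *: _]/(_ * _) mulr1.
rewrite whitney_sum_above //; congr (nat_of_bool _)%:R.
have [-> | nYW] := eqVneq Y W.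
  by apply/hasPn => B; rewrite sAA => /proper.
have [B BA YB] := lattice_below_member YL nYW.
by apply/negbF/hasP; exists B; rewrite ?sAA.
Qed.

(** Induction on the codimension of [Y] in [W]: the spaces [Z] in the recursion strictly contain
    [Y], so theirs is smaller. *)
Lemma moebius_whitney W AA s Y :
  s =i AA -> {in AA, forall B, ~~ (W <= B)%VS} ->
  Y \in intersection_lattice W AA ->
  moebius (@rev_incl K vT) (intersection_lattice W AA) W Y =
  whitney_sum (fun V => (V == Y)%:R) W s.
Proof.
set L := intersection_lattice W AA => sAA proper.
have [k] := ubnP (\dim W - \dim Y); elim: k Y => // k IH Y ltk YL.
have := whitney_sum_above_lattice sAA proper YL; rewrite -/L.
rewrite big_mkcond (big_fsetD1 Y) //= subvv -big_mkcond /=.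
have -> : \sum_(Z <- L `\ Y | (Y <= Z)%VS)
     whitney_sum (fun V => (V == Z)%:R : int) W s =
   \sum_(Z <- L | [&& rev_incl W Z, rev_incl Z Y & Z != Y])
     moebius (@rev_incl K vT) L W Z.
  apply: eq_fbig_cond => [Z | Z].
    rewrite !inE /= /rev_incl; case ZL: (Z \in L); rewrite ?andbF //=.
    by rewrite (lattice_sub ZL) andbT andbC.
  rewrite !inE => /andP[nZY ZL] YZ; rewrite IH //.
  have ltYZ : (\dim Y < \dim Z)%N.
    by rewrite (ltn_leqif (dimv_leqif_eq YZ)) eq_sym.
  move: ltk; rewrite ltnS; apply: leq_trans; rewrite ltn_sub2l //.
  exact: leq_trans ltYZ (dimvS (lattice_sub ZL)).
(* For [Y = W] no lattice element strictly contains [Y], so only the coefficient itself remains and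
   it equals 1. *)
have [-> | nYW] := eqVneq Y W.
  rewrite moebius_xx big1 ?addr0 // => Z /and3P[ZW WZ /eqP[]].
  by apply: rev_incl_anti; rewrite ZW WZ.
rewrite moebiusE ?(eq_sym W) //; last 3 first.
- exact: rev_incl_refl.
- exact: rev_incl_anti.
- exact: rev_incl_trans.
by move/eqP; rewrite addr_eq0 => /eqP ->.
Qed.

Lemma arr_chi_whitney W AA s :
  s =i AA -> {in AA, forall B, ~~ (W <= B)%VS} ->
  arr_chi W AA = whitney_sum (fun V => 'X^(\dim V)) W s.
Proof.
move=> sAA proper; rewrite (whitney_sum_expand _ _ sAA) /arr_chi.
by rewrite big_seq [RHS]big_seq; apply: eq_bigr => Y YL; rewrite (moebius_whitney sAA).
Qed.

(** Passing to a strictly larger member raises the dimension, which that of [vT] bounds. *)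
Lemma maximal_members_above (CC : {fset {vspace vT}}) Y : Y \in CC ->
  exists2 Z, Z \in maximal_members CC & (Y <= Z)%VS.
Proof.
have [k] := ubnP (\dim {:vT} - \dim Y); elim: k Y => // k IH Y ltk YC.
have [maxY | ] := boolP (all (fun Z => (Y <= Z)%VS ==> (Y == Z)) CC).
  by exists Y; rewrite // !inE /= YC.
case/allPn => Z ZC; rewrite negb_imply => /andP[YZ nYZ].
have ltYZ : (\dim Y < \dim Z)%N by rewrite (ltn_leqif (dimv_leqif_eq YZ)).
have [|T TC ZT] := IH Z _ ZC; last by exists T; rewrite // (subv_trans YZ).
move: ltk; rewrite ltnS; apply: leq_trans; rewrite ltn_sub2l //.
exact: leq_trans ltYZ (dimvS (subvf Z)).
Qed.

(** Members of the deletion need not lie in [A], but a Whitney sum started at [A] sees only their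
    traces [A :&: B], each of which lies in a maximal one. *)
Lemma whitney_sum_restriction (M : zmodType) (phi : {vspace vT} -> M) AA A :
  whitney_sum phi A (restriction AA A) = whitney_sum phi A (deletion AA A).
Proof.
apply: whitney_sum_cofinal => C.
  rewrite !inE => /andP[/imfsetP[B BA ->] _]; exists B => //.
  by rewrite (subv_trans (capvSr _ _)) ?capvSr.
move=> CA; apply: maximal_members_above.
by apply/imfsetP; exists C.
Qed.

(** The hypothesis [A != W] excludes [AA = {W}], where the left side is [x^(dim W)] and the right
    side is 0. *)
Theorem deletion_restriction W AA A :
  arrangement W AA -> A \in AA -> A != W ->
  arr_chi W AA = arr_chi W (deletion AA A) - arr_chi A (restriction AA A).
Proof.
move=> [sub anti] AA_A nAW.
(* From [W <= B] follows [A <= B], hence [A = B] and then [A = W]. *)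
have proper : {in AA, forall B, ~~ (W <= B)%VS}.
  move=> B BA; apply/negP => WB; case/eqP: nAW; apply/eqP.
  rewrite eqEsubv (sub _ AA_A) (anti A B) //.
  exact: subv_trans (sub _ AA_A) WB.
(* With [A] listed first, one unfolding of [whitney_sum] is the required difference. *)
have sAA : A :: deletion AA A =i AA.
  by move=> B; rewrite !inE; case: eqVneq => [-> | ].
rewrite (arr_chi_whitney sAA proper) /=; congr (_ - _).
  rewrite (arr_chi_whitney (s := deletion AA A)) // => B.
  by rewrite !inE => /andP[_ /proper].
rewrite (arr_chi_whitney (s := restriction AA A)) //; last first.
  (* If [A <= A :&: B], then [A <= B], so [A = B], which the deletion of [A] rules out. *)
  move=> C; rewrite !inE => /andP[/imfsetP[B]].
  rewrite !inE => /andP[nBA BA] -> _; rewrite subv_cap subvv /=.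
  by apply: contraNN nBA => /(anti _ _ AA_A BA) ->.
by rewrite whitney_sum_restriction (capv_idPr (sub _ AA_A)).
Qed.

End CharacteristicPolynomial.

Theorem theorem2p1 (R : realType) (n : nat)
  (AA : {fset {vspace 'rV[R]_n}}) (A : {vspace 'rV[R]_n})
  (hAA : arrangement fullv AA) (hA : A \in AA)
  (A_proper : A != fullv) :
  arr_chi fullv AA = arr_chi fullv (deletion AA A) - arr_chi A (restriction AA A).
Proof. exact: deletion_restriction. Qed.
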